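(* Let $\varepsilon<\frac3{10}\left(1-\sqrt{\tfrac12\log\tfrac43}\right)$ be a constant. If the error of the protocol $P$ is bounded by $\varepsilon$, then there is a constant $c(\varepsilon)>0$, depending only on $\varepsilon$, such that $\operatorname{I}(M(\vec Z):\vec Z\mid D)\ge c(\varepsilon)/k$.
   Context: $P$ is an arbitrary randomized $k$-player protocol in the number in the hand model: player $i$ knows only the $i$-th input bit and has private random bits independent of the inputs, and the players communicate via a shared blackboard. $P$ computes $\operatorname{AND}_k$ (conjunction of $k$ bits) with error at most $\varepsilon$ on every input. $M(\vec z)$ is the random transcript of $P$ on input $\vec z$. The random variables $\vec Z\in\{0,1\}^k$ and $D\in\{1,\dots,k\}$ are distributed as follows. $D$ is uniform. Given $D=i$, we have $Z_j=0$ for $j\neq i$, and $Z_i$ is a uniform bit. The random bits of $P$ are independent of $(\vec Z,D)$. Logarithms are base $2$. *)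

(* Defs.v *)
From HB Require Import structures.
From mathcomp Require Import all_boot all_order all_algebra.
From mathcomp Require Import all_classical all_reals all_analysis.
Set Implicit Arguments.
Unset Strict Implicit.
Unset Printing Implicit Defensive.
Import Order.TTheory GRing.Theory Num.Theory.
Local Open Scope classical_set_scope.
Local Open Scope ring_scope.

Definition log2 (R : realType) (x : R) : R := ln x / ln 2.

Definition pr (R : realType) (d : measure_display) (Omega : measurableType d)
  (P : probability Omega R) (A : set Omega) : R := fine (P A).

(* Equal to 0 when [B] is a null event, by the convention [x / 0 = 0]. *)
Definition cpr (R : realType) (d : measure_display) (Omega : measurableType d)
  (P : probability Omega R) (A B : set Omega) : R :=
  pr P (A `&` B) / pr P B.

Definition finite_rv (d : measure_display) (Omega : measurableType d)
  (S : finType) (X : Omega -> S) : Prop :=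
  forall s : S, measurable (X @^-1` [set s]).

(* Terms with probability 0 contribute 0 to the sum. *)
Definition entropy_given (R : realType) (d : measure_display)
  (Omega : measurableType d) (P : probability Omega R)
  (S : finType) (X : Omega -> S) (E : set Omega) : R :=
  - \sum_(s : S) cpr P (X @^-1` [set s]) E * log2 (cpr P (X @^-1` [set s]) E).

Definition cond_entropy (R : realType) (d : measure_display)
  (Omega : measurableType d) (P : probability Omega R)
  (S T : finType) (X : Omega -> S) (Y : Omega -> T) : R :=
  \sum_(t : T) pr P (Y @^-1` [set t]) * entropy_given P X (Y @^-1` [set t]).

Definition cond_mutual_info (R : realType) (d : measure_display)
  (Omega : measurableType d) (P : probability Omega R)
  (S T U : finType) (X : Omega -> S) (Y : Omega -> T) (W : Omega -> U) : R :=
  cond_entropy P X W - cond_entropy P X (fun w => (Y w, W w)).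

(* A blackboard protocol in the number-in-the-hand model, as a protocol tree.
   The node reached is the blackboard content; it determines whose turn it is.
   At [Speak i f next] player [i] writes the bit [f x_i r_i], where [x_i] is its
   input bit and [r_i : T i] the value of its private random source.  Thus
   different sources for different players, and sources that are not finite
   strings of fair coins, are allowed.  [Output b] ends the protocol with
   result [b]. *)
Inductive protocol (k : nat) (dT : measure_display)
  (T : 'I_k -> measurableType dT) : Type :=
| Output (b : bool)
| Speak (i : 'I_k) (f : bool -> {mfun T i >-> bool}) (next : bool -> protocol T).

Section Protocol.
Context {k : nat} {dT : measure_display} {T : 'I_k -> measurableType dT}.

Fixpoint depth (p : protocol T) : nat :=
  match p with
  | Output _ => 0%N
  | Speak _ _ next => (maxn (depth (next false)) (depth (next true))).+1
  end.

Fixpoint run (p : protocol T) (x : {ffun 'I_k -> bool}) (r : forall i, T i) :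
    seq bool :=
  match p with
  | Output _ => [::]
  | Speak i f next => let b := f (x i) (r i) in b :: run (next b) x r
  end.

Lemma size_run p x r : (size (run p x r) <= depth p)%N.
Proof.
elim: p => [b|i f next IH] //=; rewrite ltnS.
by apply: leq_trans (IH _) _; case: (f _ _); rewrite leq_max leqnn ?orbT.
Qed.

(* The bound on the length only serves to make the transcripts a [finType]. *)
Definition transcript (p : protocol T) (x : {ffun 'I_k -> bool})
    (r : forall i, T i) : (depth p).-bseq bool :=
  Bseq (size_run p x r).

(* The value on a bit string that is too short to reach a leaf is irrelevant. *)
Fixpoint result (p : protocol T) (m : seq bool) : bool :=
  match p, m with
  | Output b, _ => b
  | Speak _ _ next, b :: m' => result (next b) m'
  | Speak _ _ _, [::] => false
  end.

End Protocol.

Definition AND (k : nat) (x : {ffun 'I_k -> bool}) : bool := [forall i, x i].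

Definition error_at_most (R : realType) (k : nat) (d dT : measure_display)
  (Omega : measurableType d) (P : probability Omega R)
  (T : 'I_k -> measurableType dT) (r : forall i, {mfun Omega >-> T i})
  (p : protocol T) (eps : R) : Prop :=
  forall x : {ffun 'I_k -> bool},
    pr P [set w | result p (transcript p x (fun i => r i w)) != AND x] <= eps.

Definition input_law (R : realType) (k : nat) (d : measure_display)
  (Omega : measurableType d) (P : probability Omega R)
  (Z : Omega -> {ffun 'I_k -> bool}) (D : Omega -> 'I_k) : Prop :=
  (forall i, pr P (D @^-1` [set i]) = k%:R^-1) /\
  (forall i z, cpr P (Z @^-1` [set z]) (D @^-1` [set i]) =
     if [forall j, (j != i) ==> ~~ z j] then 2^-1 else 0).

(* Mutual independence of the k + 1 variables [X], [r_0], ..., [r_(k-1)]; the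
   product rule for subfamilies is the case where some [A i] are [setT] and one
   sums over the values of [X]. *)
Definition independent_of_sources (R : realType) (k : nat)
  (d dT : measure_display) (Omega : measurableType d) (P : probability Omega R)
  (S : finType) (X : Omega -> S)
  (T : 'I_k -> measurableType dT) (r : forall i, {mfun Omega >-> T i}) : Prop :=
  forall (s : S) (A : forall i, set (T i)), (forall i, measurable (A i)) ->
    pr P (X @^-1` [set s] `&` [set w | forall i, A i (r i w)]) =
    pr P (X @^-1` [set s]) * \prod_(i < k) pr P (r i @^-1` A i).

(* Main.v *)
Require Import Defs.
From HB Require Import structures.
From mathcomp Require Import all_boot all_order all_algebra all_fingroup.
From mathcomp Require Import all_classical all_reals all_analysis.
From mathcomp Require Import ring lra.
Set Implicit Arguments.
Unset Strict Implicit.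
Unset Printing Implicit Defensive.
Import Order.TTheory GRing.Theory Num.Theory.
Local Open Scope classical_set_scope.
Local Open Scope ring_scope.

(** For a transcript [m], the probability of [m] on input [x] is a product over
    the players of factors depending on [x i] only.  Hence the affinity
    [\sum_m sqrt (P_x m * P_y m)] is unchanged when coordinates of [x] and [y]
    are swapped, so that, for disjoint sets of players [A] and [B], the
    Hellinger distance between [P_A] and [P_B] equals the one between [P_0] and
    [P_(A u B)].  For [t] disjoint sets, bounding the variance of the vectors
    [sqrt P_(A_v)] by their second moment around [sqrt P_0] gives
    [\sum_(u < v) h^2(0, A_u u A_v) <= t * \sum_v h^2(0, A_v)].  Averaging over
    all ways to merge [2^l] sets in pairs then loses only a factor [1 - 2^-l],
    and since [\prod_l (1 - 2^-l)] stays above [1/4],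
    [\sum_i h^2(0, e_i) >= h^2(0, 1) / 4] (Jayram).  The right-hand side is
    bounded below because the protocol separates [0] from [1], and the left-hand
    side is, up to a constant, [k] times the information cost, which is an
    average of Jensen-Shannon divergences of [P_0] and [P_(e_i)]. *)

(** * Averages over permutations of a finite set *)

Lemma le_of_eq (R : porderZmodType) (x y : R) : x = y -> x <= y.
Proof. by move=> ->. Qed.

(** Permutations are transitive on ordered pairs of distinct points: composing with some [t] that
    sends [(a', b')] to [(a, b)] reindexes the sum. *)
Lemma perm_sum_pair (R : nmodType) (T : finType) (g : T -> T -> R)
    (a b a' b' : T) : a != b -> a' != b' ->
  \sum_(s : {perm T}) g (s a) (s b) = \sum_(s : {perm T}) g (s a') (s b').
Proof.
move=> ab ab'.
have [t ta tb] : exists2 t : {perm T}, t a' = a & t b' = b.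
  exists (tperm a' a * tperm (tperm a' a b') b)%g; rewrite permM ?tpermL //.
  by rewrite tpermD 1?eq_sym // -{1}(tpermL a' a) (inj_eq perm_inj).
rewrite [RHS](reindex_inj (mulgI t)) /=.
by apply: eq_bigr => s _; rewrite !permM ta tb.
Qed.

(** The sum over ordered pairs is invariant under relabelling by each [s]; after exchanging sums,
    every pair contributes the same amount by [perm_sum_pair]. *)
Lemma perm_sum_pair_avg (R : comNzRingType) (T : finType) (g : T -> T -> R)
    (a b : T) : a != b ->
  (#|T|%:R * (#|T|%:R - 1)) * \sum_(s : {perm T}) g (s a) (s b) =
  #|{perm T}|%:R * \sum_u \sum_(v | v != u) g u v.
Proof.
move=> ab; set K := \sum_(s : {perm T}) _.
have -> : #|{perm T}|%:R * \sum_u \sum_(v | v != u) g u v =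
    \sum_(s : {perm T}) \sum_u \sum_(v | v != u) g (s u) (s v).
  rewrite [RHS](eq_bigr (fun=> \sum_u \sum_(v | v != u) g u v)) => [|s _].
    by rewrite sumr_const mulr_natl.
  rewrite [RHS](reindex_inj (@perm_inj _ s)) /=; apply: eq_bigr => u _.
  rewrite [RHS](reindex_inj (@perm_inj _ s)) /=; apply: eq_bigl => v.
  by rewrite (inj_eq perm_inj).
rewrite exchange_big /= (eq_bigr (fun=> (#|T|%:R - 1) * K)) => [|u _].
  by rewrite sumr_const -[RHS]mulr_natl mulrA.
rewrite exchange_big /= (eq_bigr (fun=> K)) => [|v vu]; last first.
  by apply: perm_sum_pair => //; rewrite eq_sym.
rewrite sumr_const -[LHS]mulr_natl; congr (_ * _).
have -> : #|T| = #|[pred v | v != u]|.+1.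
  rewrite (cardD1 u) /= add1n; congr _.+1.
  by apply: eq_card => v; rewrite !inE andbT.
by rewrite -addn1 natrD addrK.
Qed.

(** * Merging classes of a partition in pairs *)

Section Doubling.
Variables (R : realFieldType) (I : finType) (f : {ffun I -> bool} -> R).

Hypothesis f_pairs : forall (V : finType) (phi : I -> V),
  \sum_u \sum_(v | v != u) f [ffun i => (phi i == u) || (phi i == v)] <=
  2 * #|V|%:R * \sum_v f [ffun i => phi i == v].

(** With [n = 2 * #|V|] classes, a random pairing has [#|V|] pairs, each distributed as a uniform
    ordered pair. By [f_pairs] the expected sum over merged classes is at most [n / (n - 1)] times
    the sum over classes. *)
Lemma doubling_step (V : finType) (C : R) (phi : I -> V * bool) :
  (0 < #|V|)%N ->
  (forall psi : I -> V,
    C * f [ffun=> true] <= \sum_v f [ffun i => psi i == v]) ->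
  (1 - #|{: V * bool}|%:R^-1) * C * f [ffun=> true] <=
  \sum_v f [ffun i => phi i == v].
Proof.
move=> V0 H.
pose g (u v : V * bool) := f [ffun i => (phi i == u) || (phi i == v)].
have Hs (s : {perm V * bool}) :
    C * f [ffun=> true] <= \sum_v g (s (v, false)) (s (v, true)).
  (* Class [v] of this map is the union of the [phi]-classes [s (v, false)] and [s (v, true)]. *)
  apply: le_trans (H (fun i => ((s^-1)%g (phi i)).1)) _.
  apply: ler_sum => v _; rewrite /g; apply: le_of_eq.
  congr f; apply/ffunP => i; rewrite !ffunE.
  have E w : (phi i == s w) = ((s^-1)%g (phi i) == w).
    by rewrite -(inj_eq (@perm_inj _ s) _ w) permKV.
  rewrite !E; case: ((s^-1)%g (phi i)) => v' [] /=;
    by rewrite !xpair_eqE /= ?andbT ?andbF ?orbF.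
set S := \sum_v f _.
set n : R := #|{: V * bool}|%:R.
have nE : n = #|V|%:R * 2 by rewrite /n card_prod card_bool natrM.
have V1 : 1 <= #|V|%:R :> R by rewrite ler1n.
set N : R := #|{perm V * bool}|%:R.
have N0 : 0 < N by rewrite ltr0n; apply/card_gt0P; exists 1%g.
have := f_pairs phi; rewrite -/n -/S -/(g _ _) => Hp.
have sumH : N * (C * f [ffun=> true]) <=
    \sum_v \sum_(s : {perm V * bool}) g (s (v, false)) (s (v, true)).
  by rewrite exchange_big /= mulr_natl -sumr_const; apply: ler_sum.
have avg v :
    n * (n - 1) * \sum_(s : {perm V * bool}) g (s (v, false)) (s (v, true)) =
    N * \sum_u \sum_(w | w != u) g u w.
  by apply: perm_sum_pair_avg; rewrite xpair_eqE andbF.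
have n2 : 2 <= n by rewrite nE ler_peMl.
have n0 : 0 < n by apply: lt_le_trans n2.
have n1 : 0 < n * (n - 1).
  by rewrite mulr_gt0 // subr_gt0 (lt_le_trans _ n2) ?ltr1n.
have key : (n * (n - 1)) * (N * (C * f [ffun=> true])) <= N * (n * (n * S)).
  apply: le_trans (ler_wpM2l (ltW n1) sumH) _.
  rewrite mulr_sumr (eq_bigr _ (fun v _ => avg v)) sumr_const.
  rewrite -[leLHS]mulr_natl mulrCA.
  rewrite ler_wpM2l ?(ltW N0) //.
  apply: le_trans (ler_wpM2l _ Hp) _; first by rewrite ler0n.
  by rewrite nE; apply: le_of_eq; ring.
rewrite -(ler_pM2l N0) -(ler_pM2l n0) -(ler_pM2l n0).
apply: le_trans _ (le_trans key _); apply: le_of_eq.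
  by field; rewrite gt_eqF.
by ring.
Qed.

(* Index types of cardinality [2 ^ l], made so that the classes indexed by
   [dyadic l.+1] can be merged in pairs indexed by [dyadic l]. *)
Fixpoint dyadic (l : nat) : finType :=
  if l is l'.+1 then (dyadic l' * bool)%type else unit.

Lemma card_dyadic l : #|dyadic l| = (2 ^ l)%N.
Proof.
by elim: l => [|l IH]; rewrite ?card_unit //= card_prod IH card_bool expnSr.
Qed.

Lemma dyadic_bound l (phi : I -> dyadic l) :
  \prod_(j < l) (1 - (2 ^+ j.+1)^-1) * f [ffun=> true] <=
  \sum_v f [ffun i => phi i == v].
Proof.
elim: l phi => [|l IH] phi.
  rewrite big_ord0 mul1r (bigD1 tt) //= [X in _ + X]big1 => [|[] //].
  rewrite addr0; apply: le_of_eq; congr f.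
rewrite big_ord_recr /= [_ * (1 - _)]mulrC -natrX -(card_dyadic l.+1).
by apply: doubling_step => //; rewrite card_dyadic expn_gt0.
Qed.

Lemma prod_dyadic_ge l : 4^-1 <= \prod_(j < l) (1 - (2 ^+ j.+1)^-1) :> R.
Proof.
case: l => [|l]; first by rewrite big_ord0; lra.
(* The summand that vanishes as [l] grows makes the induction go through. *)
suff : 4^-1 + (2 ^+ l.+2)^-1 <= \prod_(j < l.+1) (1 - (2 ^+ j.+1)^-1) :> R.
  by apply: le_trans; rewrite lerDl invr_ge0 exprn_ge0.
elim: l => [|l IH]; first by rewrite big_ord_recr big_ord0 /= !exprS expr0; lra.
rewrite big_ord_recr /=; set x : R := (2 ^+ l.+2)^-1 in IH *.
have -> : (2 ^+ l.+3)^-1 = x / 2 :> R by rewrite /x exprS invfM mulrC.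
have x0 : 0 < x by rewrite invr_gt0 exprn_gt0.
(* Needed because [(1/4 + x)(1 - x) - (1/4 + x/2) = x (1/4 - x)]. *)
have x4 : x <= 4^-1.
  rewrite lef_pV2 ?posrE ?exprn_gt0 // !exprS.
  by have : 1 <= 2 ^+ l :> R by [apply: exprn_ege1; rewrite ler1n]; lra.
have : (4^-1 + x) * (1 - x) <= \prod_(j < l.+1) (1 - (2 ^+ j.+1)^-1) * (1 - x).
  by rewrite ler_wpM2r //; lra.
by move=> h; apply: le_trans h; nra.
Qed.

Lemma singletons_bound : (forall S, 0 <= f S) -> f [ffun=> false] = 0 ->
  4^-1 * f [ffun=> true] <= \sum_i f [ffun j => j == i].
Proof.
move=> f0 fset0.
have lt_l : (#|I| <= #|dyadic #|I| |)%N by rewrite card_dyadic ltnW // ltn_expl.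
pose phi i : dyadic #|I| := enum_val (widen_ord lt_l (enum_rank i)).
have phi_inj : injective phi.
  by move=> i j /enum_val_inj /(congr1 val) /= /val_inj /enum_rank_inj.
apply: le_trans (ler_wpM2r (f0 _) (prod_dyadic_ge #|I|)) _.
apply: le_trans (dyadic_bound phi) _.
rewrite (bigID (fun v => v \in codom phi)) /= [X in _ + X]big1 => [|v vN].
  rewrite addr0 -big_uniq ?codom_uniq /=; last exact/injectiveP.
  rewrite /image_mem /codom big_map big_enum /=; apply: le_of_eq.
  apply: eq_bigr => i _; congr f; apply/ffunP => j.
  by rewrite !ffunE (inj_eq phi_inj).
rewrite -[RHS]fset0; congr f; apply/ffunP => i; rewrite !ffunE.
by apply: contraNF vN => /eqP <-; apply: codom_f.
Qed.

End Doubling.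

(** * Inequalities for variance and entropy *)

Lemma sum_sqr_diff_le (R : realFieldType) (V : finType) (a : V -> R) (b : R) :
  \sum_u \sum_v (a u - a v) ^+ 2 <= 2 * #|V|%:R * \sum_v (a v - b) ^+ 2.
Proof.
(* In terms of [y] the left side is [2 #|V|] times the sum of [y v ^+ 2], minus twice the square of
   the sum of [y v]. *)
pose y v := a v - b.
have -> : \sum_u \sum_v (a u - a v) ^+ 2 =
    \sum_u (#|V|%:R * y u ^+ 2 + \sum_v y v ^+ 2 - 2 * y u * \sum_v y v).
  apply: eq_bigr => u _.
  have -> : #|V|%:R * y u ^+ 2 = \sum_(v : V) y u ^+ 2.
    by rewrite sumr_const mulr_natl.
  rewrite mulr_sumr -big_split /= -sumrB.
  by apply: eq_bigr => v _; rewrite /y; ring.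
rewrite sumrB big_split /= -mulr_sumr -mulr_suml -mulr_sumr sumr_const.
rewrite -[X in _ + X - _]mulr_natl.
by have := sqr_ge0 (\sum_v y v); rewrite /y; nra.
Qed.

(** The right side is one term of a Jensen-Shannon divergence; the bound comes from [ln y <= y - 1]
    applied to ratios of square roots. *)
Lemma entropy_gap (R : realType) (p q : R) : 0 <= p -> 0 <= q ->
  4^-1 * (Num.sqrt p - Num.sqrt q) ^+ 2 <=
  2^-1 * (p * log2 p) + 2^-1 * (q * log2 q) - (p + q) / 2 * log2 ((p + q) / 2).
Proof.
move=> p0 q0; set s := (p + q) / 2.
have s0 : 0 <= s by rewrite /s; lra.
set b := Num.sqrt s.
have b0 : 0 <= b by exact: sqrtr_ge0.
have bE : b ^+ 2 = s by rewrite sqr_sqrtr.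
have ln2 : 0 < ln 2 :> R by rewrite ln_gt0 // ltr1n.
have ln2le : ln 2 <= 1 :> R.
  by have := le_ln1Dx (x := 1 : R) ltac:(lra); rewrite (_ : 1 + 1 = 2).
(* [x * ln (x / s) = - 2 * x * ln (b / sqrt x) >= 2 * x * (1 - b / sqrt x)]. *)
have key x : 0 <= x -> (0 < x -> 0 < s) ->
    2 * x - 2 * b * Num.sqrt x <= x * ln x - x * ln s.
  move=> x0 xs; set a := Num.sqrt x.
  have a0 : 0 <= a by exact: sqrtr_ge0.
  have aE : a ^+ 2 = x by rewrite sqr_sqrtr.
  move: x0; rewrite le_eqVlt => /orP[/eqP x0|xp].
    by rewrite /a -x0 sqrtr0; lra.
  have sp := xs xp.
  have ap : 0 < a by rewrite sqrtr_gt0.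
  have bp : 0 < b by rewrite sqrtr_gt0.
  have : ln (b / a) <= b / a - 1.
    rewrite -[X in ln X](subrKC 1); apply: le_ln1Dx.
    by rewrite ltrBrDl subrr divr_gt0.
  rewrite ln_div ?posrE // -aE -bE !lnXn // !mulr2n => h.
  have : a ^+ 2 * (ln b - ln a) <= a ^+ 2 * (b / a - 1).
    by rewrite ler_wpM2l ?sqr_ge0.
  have -> : a ^+ 2 * (b / a - 1) = a * b - a ^+ 2 by field; rewrite gt_eqF.
  by lra.
have hp := key p p0 ltac:(rewrite /s; lra).
have hq := key q q0 ltac:(rewrite /s; lra).
set u := Num.sqrt p in hp *; set v := Num.sqrt q in hq *.
have u0 : 0 <= u by exact: sqrtr_ge0.
have v0 : 0 <= v by exact: sqrtr_ge0.
have uE : u ^+ 2 = p by rewrite sqr_sqrtr.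
have vE : v ^+ 2 = q by rewrite sqr_sqrtr.
have buv : b ^+ 2 = (u ^+ 2 + v ^+ 2) / 2 by rewrite bE uE vE.
have -> : 2^-1 * (p * log2 p) + 2^-1 * (q * log2 q) - s * log2 s =
    (2^-1 * (p * ln p) + 2^-1 * (q * ln q) - s * ln s) / ln 2.
  by rewrite /log2; field; rewrite gt_eqF.
rewrite ler_pdivlMr //.
have uvb : u + v <= 2 * b.
  rewrite -(@ler_pXn2r _ 2) ?nnegrE //; [|lra|lra].
  by have := sqr_ge0 (u - v); nra.
have lb : 4^-1 * (u - v) ^+ 2 <=
    2^-1 * (p * ln p) + 2^-1 * (q * ln q) - s * ln s.
  have h1 : s * ln s = 2^-1 * (p * ln s) + 2^-1 * (q * ln s).
    by rewrite /s; field.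
  (* The difference of the two sides is exactly [(2b - u - v)^2], as
     [(u - v)^2 = 4b^2 - (u + v)^2]. *)
  have h2 : (u - v) ^+ 2 <= 4 * b * (2 * b - u - v).
    have : 0 <= (2 * b - u - v) * (2 * b - u - v) by rewrite mulr_ge0 //; lra.
    by nra.
  rewrite h1.
  by nra.
(* As [ln 2 <= 1], passing to base 2 preserves the bound. *)
apply: le_trans lb.
by rewrite ler_piMr // mulr_ge0 // ?sqr_ge0 // invr_ge0.
Qed.

(** * Hellinger distance for laws of product form *)

Section ProductFamily.
Variables (R : realType) (I M : finType) (q : I -> bool -> M -> R).
Hypothesis q_ge0 : forall i b m, 0 <= q i b m.

(** The single factors are not normalised in [m]; only the products are assumed to sum to 1. *)
Definition plaw (x : {ffun I -> bool}) (m : M) : R := \prod_i q i (x i) m.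

Hypothesis plaw_sum1 : forall x, \sum_m plaw x m = 1.

(* Twice the squared Hellinger distance. *)
Definition hell (x y : {ffun I -> bool}) : R :=
  \sum_m (Num.sqrt (plaw x m) - Num.sqrt (plaw y m)) ^+ 2.

Lemma plaw_ge0 x m : 0 <= plaw x m.
Proof. exact: prodr_ge0. Qed.

Lemma hell_ge0 x y : 0 <= hell x y.
Proof. by apply: sumr_ge0 => m _; apply: sqr_ge0. Qed.

Lemma hellE x y : hell x y = 2 - 2 * \sum_m Num.sqrt (plaw x m * plaw y m).
Proof.
transitivity
  (\sum_m (plaw x m + plaw y m - 2 * Num.sqrt (plaw x m * plaw y m))).
  apply: eq_bigr => m _; rewrite sqrrB !sqr_sqrtr ?plaw_ge0 //.
  rewrite sqrtrM ?plaw_ge0 //.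
  by rewrite -mulr_natl; ring.
by rewrite sumrB big_split /= !plaw_sum1 mulr_sumr.
Qed.

Lemma hell_cut_paste (x y z t : {ffun I -> bool}) :
  (forall i, (x i, y i) = (z i, t i) \/ (x i, y i) = (t i, z i)) ->
  hell x y = hell z t.
Proof.
move=> H; rewrite !hellE; congr (_ - _ * _); apply: eq_bigr => m _.
congr Num.sqrt; rewrite /plaw -!big_split /=; apply: eq_bigr => i _.
by case: (H i) => -[-> ->] //; rewrite mulrC.
Qed.

Lemma hell_pairs (V : finType) (phi : I -> V) :
  \sum_u \sum_(v | v != u)
     hell [ffun=> false] [ffun i => (phi i == u) || (phi i == v)] <=
  2 * #|V|%:R * \sum_v hell [ffun=> false] [ffun i => phi i == v].
Proof.
pose A v : {ffun I -> bool} := [ffun i => phi i == v].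
apply: (@le_trans _ _ (\sum_u \sum_v hell (A u) (A v))).
  apply: ler_sum => u _; rewrite [leRHS](bigID (fun v => v != u)) /=.
  rewrite -[leLHS]addr0 lerD //; last first.
    by apply: sumr_ge0 => v _; apply: hell_ge0.
  apply: ler_sum => v vu; apply: le_of_eq.
  apply: hell_cut_paste => i; rewrite !ffunE.
  (* Players in class [u] have their two bits swapped; for all others the pairs already agree. *)
  have [->|_] := eqVneq (phi i) u; last by left.
  by rewrite eq_sym (negbTE vu); right.
rewrite /hell; under eq_bigr do rewrite exchange_big /=.
rewrite exchange_big /= [X in _ * X]exchange_big /= mulr_sumr.
apply: ler_sum => m _.
apply: le_trans (sum_sqr_diff_le _ (Num.sqrt (plaw [ffun=> false] m))) _.
rewrite ler_wpM2l ?mulr_ge0 //; apply: le_of_eq.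
by apply: eq_bigr => v _; rewrite -sqrrN opprB.
Qed.

Lemma hell_singletons :
  4^-1 * hell [ffun=> false] [ffun=> true] <=
  \sum_i hell [ffun=> false] [ffun j => j == i].
Proof.
apply: (singletons_bound (f := hell [ffun=> false])).
- exact: hell_pairs.
- by move=> S; apply: hell_ge0.
- by rewrite /hell big1 // => m _; rewrite subrr expr0n.
Qed.

Lemma hell_separated (x y : {ffun I -> bool}) (B : pred M) (e : R) :
  \sum_(m | B m) plaw x m <= e -> \sum_(m | ~~ B m) plaw y m <= e ->
  e <= 3 / 10 -> 25^-1 <= hell x y.
Proof.
move=> hx hy he.
have hB : 1 - e <= \sum_(m | B m) plaw y m.
  by have := plaw_sum1 y; rewrite (bigID B) /=; lra.
(* With [a], [b] the square roots, [b^2 - a^2 <= 5 (a - b)^2 + (a + b)^2 / 20] and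
   [(a + b)^2 <= 2 (a^2 + b^2)]. Summing gives [1 - 2e <= 5 h + 1/5], where [h] is [hell x y], and
   [e <= 3/10] yields [1/25]. *)
have : \sum_(m | B m) plaw y m - \sum_(m | B m) plaw x m <=
    \sum_m (5 * (Num.sqrt (plaw x m) - Num.sqrt (plaw y m)) ^+ 2 +
            10^-1 * (plaw x m + plaw y m)).
  rewrite -sumrB [leRHS](bigID B) /= -[leLHS]addr0 lerD //.
    apply: ler_sum => m _.
    have := sqr_sqrtr (plaw_ge0 x m); have := sqr_sqrtr (plaw_ge0 y m).
    set a := Num.sqrt (plaw x m); set b := Num.sqrt (plaw y m) => <- <-.
    by have := sqr_ge0 (10 * (a - b) + (a + b)); have := sqr_ge0 (a - b); nra.
  apply: sumr_ge0 => m _; rewrite addr_ge0 // mulr_ge0 ?sqr_ge0 //.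
  by rewrite addr_ge0 ?plaw_ge0.
rewrite big_split /= -!mulr_sumr big_split /= !plaw_sum1 -/(hell x y).
by lra.
Qed.

End ProductFamily.

(** * Finite-valued random variables *)

Section FiniteProbability.
Context (R : realType) (d : measure_display) (Omega : measurableType d).
Variable P : probability Omega R.

Lemma EFin_pr (A : set Omega) : measurable A -> (pr P A)%:E = P A.
Proof. by move=> mA; rewrite fineK // fin_num_measure. Qed.

Lemma pr_ge0 (A : set Omega) : 0 <= pr P A.
Proof. exact: fine_ge0. Qed.

Lemma pr_setT : pr P setT = 1.
Proof. by rewrite /pr probability_setT. Qed.

Lemma pr_partition (S : finType) (X : Omega -> S) (A : set Omega) :
  finite_rv X -> measurable A ->
  pr P A = \sum_(s : S) pr P (X @^-1` [set s] `&` A).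
Proof.
move=> mX mA; apply: EFin_inj; rewrite EFin_pr // -sumEFin.
have {1}-> : A = \bigcup_(s in [set: S]) (X @^-1` [set s] `&` A).
  by apply/seteqP; split => [w Aw|w [s _ []]] //; exists (X w).
have mXA s : measurable (X @^-1` [set s] `&` A) by apply: measurableI.
rewrite measure_fin_bigcup //; last 2 first.
- exact: finite_finset.
- by move=> s t _ _ [w [[/= -> _] [/= ->]]].
rewrite (@fsbigE _ _ _ _ _ (index_enum S)) ?index_enum_uniq //=; last first.
  by move=> s; rewrite mem_index_enum.
apply: eq_big => [s|s _]; first by rewrite in_setT.
by rewrite EFin_pr.
Qed.

Lemma finite_rv_pair (S T : finType) (X : Omega -> S) (Y : Omega -> T) :
  finite_rv X -> finite_rv Y -> finite_rv (fun w => (X w, Y w)).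
Proof.
move=> mX mY [s t].
rewrite (_ : _ @^-1` _ = X @^-1` [set s] `&` Y @^-1` [set t]).
  exact: measurableI.
by apply/seteqP; split => w /= => [[-> ->]|[-> ->]].
Qed.

End FiniteProbability.

(** * The rectangle property of protocols *)

Section Rectangle.
Context {k : nat} {dT : measure_display} {T : 'I_k -> measurableType dT}.

(* The values of player [i]'s private source which, given the input bit [b],
   reproduce the messages of player [i] in [s]; empty unless [s] is a complete
   path of the tree. *)
Fixpoint consistent (p : protocol T) (s : seq bool) (b : bool) :
    forall i, set (T i) :=
  match p, s with
  | Output _, [::] => fun=> setT
  | Speak j f next, c :: s' => fun i =>
      dfwith (fun i => [set: T i]) j [set t | f b t = c] i `&`
      @consistent (next c) s' b i
  | _, _ => fun=> set0
  end.

Arguments consistent p s b i _ : clear implicits.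

Lemma measurable_consistent p s b i : measurable (consistent p s b i).
Proof.
elim: p s => [c'|j f next IH] [|c s] //=.
apply: measurableI; last exact: IH.
by have [<-|ji] := eqVneq j i; rewrite ?dfwithin ?dfwithout //;
  exact: (measurable_funPTI (f b) (Y := [set c])).
Qed.

Lemma run_consistent p s x r : (0 < k)%N ->
  run p x r = s <-> forall i, consistent p s (x i) i (r i).
Proof.
move=> k0; elim: p s => [c'|j f next IH] [|c s] /=.
- by split.
(* A string that is not a complete path has empty sets on the right; some player must exist for this
   to be contradictory. *)
- by split=> // /(_ (Ordinal k0)).
- by split=> // /(_ (Ordinal k0)).
split=> [[<- /IH h] i|h].
  by split=> //; have [<-|ji] := eqVneq j i; rewrite ?dfwithin ?dfwithout.
have [] := h j; rewrite dfwithin /= => -> _; congr (_ :: _).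
by apply/IH => i; have [] := h i.
Qed.

End Rectangle.
Arguments consistent {k dT T} p s b i _.

(** * The law of the transcript on a fixed input *)

Section TranscriptLaw.
Context (R : realType) (k : nat) (d dT : measure_display)
  (Omega : measurableType d) (P : probability Omega R)
  (T : 'I_k -> measurableType dT) (r : forall i, {mfun Omega >-> T i})
  (p : protocol T).
Hypothesis k_gt0 : (0 < k)%N.

Definition message_prob (i : 'I_k) (b : bool) (m : (depth p).-bseq bool) : R :=
  pr P (r i @^-1` consistent p m b i).

Definition tlaw := plaw message_prob.

Definition transcript_event (x : {ffun 'I_k -> bool})
    (m : (depth p).-bseq bool) : set Omega :=
  [set w | transcript p x (fun i => r i w) = m].

Lemma transcript_eventE x m :
  transcript_event x m = [set w | forall i, consistent p m (x i) i (r i w)].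
Proof.
apply/seteqP; split => w /=.
  by move=> <-; apply/run_consistent.
by move=> /run_consistent h; apply: val_inj; apply: h.
Qed.

Lemma measurable_transcript_event x m : measurable (transcript_event x m).
Proof.
rewrite transcript_eventE.
rewrite (_ : [set _ | _] =
    \bigcap_(i in [set: 'I_k]) r i @^-1` consistent p m (x i) i).
  apply: fin_bigcap_measurable => // i _.
  exact/measurable_funPTI/measurable_consistent.
by apply/seteqP; split => w /= h i => [_|]; apply: h.
Qed.

Lemma message_prob_ge0 i b m : 0 <= message_prob i b m.
Proof. exact: pr_ge0. Qed.

Section Joint.
Context (S : finType) (X : Omega -> S).
Hypotheses (mX : finite_rv X) (indX : independent_of_sources P X r).

Lemma pr_joint s x m :
  pr P (X @^-1` [set s] `&` transcript_event x m) =
  pr P (X @^-1` [set s]) * tlaw x m.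
Proof.
rewrite transcript_eventE.
by apply: indX => i; apply: measurable_consistent.
Qed.

(** Independence is stated jointly with [X], so the marginal law is obtained by summing [pr_joint]
    over the values of [X]. *)
Lemma pr_transcript_event x m : pr P (transcript_event x m) = tlaw x m.
Proof.
rewrite (pr_partition P mX (measurable_transcript_event x m)).
rewrite (eq_bigr _ (fun s _ => pr_joint s x m)) -mulr_suml.
have := pr_partition P mX (@measurableT _ Omega).
rewrite pr_setT; under eq_bigr do rewrite setIT.
by move=> <-; rewrite mul1r.
Qed.

Lemma tlaw_sum1 x : \sum_m tlaw x m = 1.
Proof.
rewrite -(eq_bigr _ (fun m _ => pr_transcript_event x m)).
have mM : finite_rv (fun w => transcript p x (fun i => r i w)).
  by move=> m; apply: measurable_transcript_event.
rewrite -(pr_setT P) (pr_partition P mM (@measurableT _ Omega)).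
by apply: eq_bigr => m _; rewrite setIT.
Qed.

Lemma tlaw_error (eps : R) x : error_at_most P r p eps ->
  \sum_(m : (depth p).-bseq bool | result p m != AND x) tlaw x m <= eps.
Proof.
move=> /(_ x); apply: le_trans.
have mM : finite_rv (fun w => transcript p x (fun i => r i w)).
  by move=> m; apply: measurable_transcript_event.
set E := [set w | _].
(* The output is a function of the transcript, so [E] contains each transcript event or misses
   it. *)
have EI m : transcript_event x m `&` E =
    if result p m != AND x then transcript_event x m else set0.
  apply/seteqP; case: ifPn => h; split=> w //=; first by case.
    by move=> Em; split=> //; move: h; rewrite -Em.
  by case=> Em; rewrite /E /=; move: h; rewrite -Em /= => /negP.
rewrite (@pr_partition _ _ _ P _ _ E mM).
  rewrite [leRHS](bigID
    (fun m : (depth p).-bseq bool => result p m != AND x)) /=.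
  rewrite -[leLHS]addr0 lerD //; last by apply: sumr_ge0 => m _; apply: pr_ge0.
  apply: ler_sum => m hm; rewrite -/(transcript_event x m) EI hm.
  by rewrite pr_transcript_event.
rewrite (_ : E =
    \bigcup_(m in [set m : (depth p).-bseq bool | result p m != AND x])
      transcript_event x m).
  apply: fin_bigcup_measurable; first exact: finite_finset.
  by move=> m _; apply: measurable_transcript_event.
apply/seteqP; split=> [w h|w [m /= h Em]].
  by exists (transcript p x (fun i => r i w)).
by rewrite /E /=; move: h; rewrite -Em.
Qed.

End Joint.
End TranscriptLaw.

Arguments message_prob {R k d dT Omega} P {T} r p i b m.
Arguments tlaw {R k d dT Omega} P {T} r p x m.

(** * The input distribution and the information cost *)

Section InputLaw.
Context (R : realType) (k : nat).

Definition input_weight (i : 'I_k) (z : {ffun 'I_k -> bool}) : R :=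
  if [forall j, (j != i) ==> ~~ z j] then 2^-1 else 0.

Lemma sum_input_weight (i : 'I_k) (F : {ffun 'I_k -> bool} -> R) :
  \sum_z input_weight i z * F z =
  2^-1 * F [ffun=> false] + 2^-1 * F [ffun j => j == i].
Proof.
have ne : [ffun j => j == i] != [ffun=> false] :> {ffun 'I_k -> bool}.
  by apply/eqP => /ffunP/(_ i); rewrite !ffunE eqxx.
rewrite (bigD1 [ffun=> false]) //= (bigD1 [ffun j => j == i]) //= addrA.
rewrite [X in _ + X]big1 ?addr0; last first.
  move=> z /andP[z0 zi]; rewrite /input_weight.
  case: ifPn => [/forallP h|]; last by rewrite mul0r.
  case E : (z i).
    case/eqP: zi; apply/ffunP => j; rewrite ffunE.
    by have [->//|ji] := eqVneq j i; have := h j; rewrite ji /= => /negbTE.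
  case/eqP: z0; apply/ffunP => j; rewrite ffunE.
  by have [->//|ji] := eqVneq j i; have := h j; rewrite ji /= => /negbTE.
rewrite /input_weight !ifT //; apply/forallP => j; rewrite !ffunE ?implybT //.
exact: implybb.
Qed.

End InputLaw.

Section InformationCost.
Context (R : realType) (k : nat) (d dT : measure_display)
  (Omega : measurableType d) (P : probability Omega R)
  (T : 'I_k -> measurableType dT) (r : forall i, {mfun Omega >-> T i})
  (p : protocol T) (Z : Omega -> {ffun 'I_k -> bool}) (D : Omega -> 'I_k).
Hypotheses (k_gt0 : (0 < k)%N) (mZ : finite_rv Z) (mD : finite_rv D)
  (law : input_law P Z D)
  (ind : independent_of_sources P (fun w => (Z w, D w)) r).

Let M w := transcript p (Z w) (fun i => r i w).
Let X w := (Z w, D w).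

Let mX : finite_rv X.
Proof. exact: finite_rv_pair. Qed.

Let kV_neq0 : k%:R^-1 != 0 :> R.
Proof. by rewrite invr_eq0 pnatr_eq0 -lt0n. Qed.

Lemma pr_input z i : pr P (X @^-1` [set (z, i)]) = k%:R^-1 * input_weight R i z.
Proof.
have [hD hZ] := law.
rewrite /input_weight -hZ /cpr hD mulrCA mulfV // mulr1; congr pr.
by apply/seteqP; split=> w [<- <-].
Qed.

Lemma pr_transcript_input z i m :
  pr P (M @^-1` [set m] `&` X @^-1` [set (z, i)]) =
  k%:R^-1 * input_weight R i z * tlaw P r p z m.
Proof.
rewrite -pr_input -(pr_joint k_gt0 ind) setIC; congr pr.
by apply/seteqP; split => w /= [[<- <-]].
Qed.

Lemma cpr_transcript_input z i m : input_weight R i z != 0 ->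
  cpr P (M @^-1` [set m]) (X @^-1` [set (z, i)]) = tlaw P r p z m.
Proof.
move=> w0; rewrite /cpr pr_transcript_input pr_input mulrAC mulfV ?mul1r //.
by rewrite mulf_neq0.
Qed.

Lemma measurable_transcript m : measurable (M @^-1` [set m]).
Proof.
rewrite (_ : _ @^-1` _ = \bigcup_(z in [set: {ffun 'I_k -> bool}])
    (Z @^-1` [set z] `&` transcript_event r z m)).
  apply: fin_bigcup_measurable; first exact: finite_finset.
  by move=> z _; apply: measurableI => //; apply: measurable_transcript_event.
by apply/seteqP; split=> [w h|w [z _ [/= <-]]] //; exists (Z w).
Qed.

Lemma cpr_transcript i m :
  cpr P (M @^-1` [set m]) (D @^-1` [set i]) =
  (tlaw P r p [ffun=> false] m + tlaw P r p [ffun j => j == i] m) / 2.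
Proof.
have [hD _] := law.
rewrite /cpr hD (pr_partition P mZ); last first.
  by apply: measurableI => //; apply: measurable_transcript.
have -> :
    \sum_z pr P (Z @^-1` [set z] `&` (M @^-1` [set m] `&` D @^-1` [set i])) =
    k%:R^-1 * \sum_z input_weight R i z * tlaw P r p z m.
  rewrite mulr_sumr; apply: eq_bigr => z _.
  rewrite mulrA -pr_transcript_input setICA; congr pr.
  by apply/seteqP; split=> w [hM [<- <-]].
rewrite sum_input_weight mulrAC mulfV // mul1r mulrDl.
by congr (_ + _); rewrite mulrC.
Qed.

Let law0 := tlaw P r p [ffun=> false].
Let law1 i := tlaw P r p [ffun j => j == i].
Let ent x : R := \sum_m tlaw P r p x m * log2 (tlaw P r p x m).

(** Given [D = i], the transcript law is the even mixture of [law0] and [law1 i]; given also [Z], it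
    is one of the two. Each summand is thus their Jensen-Shannon divergence. *)
Lemma cond_mutual_infoE :
  cond_mutual_info P M Z D = k%:R^-1 * \sum_i
    (2^-1 * ent [ffun=> false] + 2^-1 * ent [ffun j => j == i] -
     \sum_m (law0 m + law1 i m) / 2 * log2 ((law0 m + law1 i m) / 2)).
Proof.
have [hD _] := law.
rewrite /cond_mutual_info /cond_entropy.
have -> : \sum_(t : {ffun 'I_k -> bool} * 'I_k)
     pr P (X @^-1` [set t]) * entropy_given P M (X @^-1` [set t]) =
   - (k%:R^-1 * \sum_i
        (2^-1 * ent [ffun=> false] + 2^-1 * ent [ffun j => j == i])).
  pose G z i := pr P (X @^-1` [set (z, i)]) *
    entropy_given P M (X @^-1` [set (z, i)]).
  rewrite (eq_bigr (fun t => G t.1 t.2)) => [|[z i] _ //].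
  rewrite -(pair_bigA _ G) exchange_big /= {}/G.
  rewrite mulr_sumr -sumrN; apply: eq_bigr => i _.
  rewrite -sum_input_weight mulr_sumr -sumrN; apply: eq_bigr => z _.
  rewrite pr_input -mulrA -mulrN; congr (_ * _).
  (* Inputs of weight 0 give null conditioning events, whose terms vanish on both sides. *)
  have [->|w0] := eqVneq (input_weight R i z) 0; first by rewrite !mul0r oppr0.
  rewrite -mulrN; congr (_ * _); rewrite /entropy_given; congr (- _).
  by apply: eq_bigr => m _; rewrite cpr_transcript_input.
rewrite opprK mulr_sumr [in RHS]mulr_sumr -big_split /=.
apply: eq_bigr => i _; rewrite hD -mulrDr addrC /entropy_given.
congr (_ * (_ - _)).
by apply: eq_bigr => m _; rewrite cpr_transcript.
Qed.

Lemma cond_mutual_info_hell :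
  k%:R^-1 * \sum_i 4^-1 *
    hell (message_prob P r p) [ffun=> false] [ffun j => j == i] <=
  cond_mutual_info P M Z D.
Proof.
rewrite cond_mutual_infoE ler_wpM2l ?invr_ge0 ?ler0n //.
apply: ler_sum => i _.
rewrite /ent /hell !mulr_sumr -big_split /= -sumrB.
apply: ler_sum => m _.
by apply: entropy_gap; apply: plaw_ge0; apply: message_prob_ge0.
Qed.

End InformationCost.

Theorem theorem3p17 (R : realType) (eps : R)
  (heps : eps < 3 / 10 * (1 - Num.sqrt (2^-1 * log2 (4 / 3)))) :
  exists2 c : R, 0 < c &
    forall (k : nat) (d dT : measure_display) (Omega : measurableType d)
      (P : probability Omega R)
      (T : 'I_k -> measurableType dT) (r : forall i, {mfun Omega >-> T i})
      (p : protocol T)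
      (Z : Omega -> {ffun 'I_k -> bool}) (D : Omega -> 'I_k),
      (0 < k)%N ->
      error_at_most P r p eps ->
      finite_rv Z -> finite_rv D ->
      input_law P Z D ->
      independent_of_sources P (fun w => (Z w, D w)) r ->
      c / k%:R <=
        cond_mutual_info P (fun w => transcript p (Z w) (fun i => r i w)) Z D.
Proof.
have eps_le : eps <= 3 / 10.
  by apply/ltW/(lt_le_trans heps); rewrite ler_piMr ?gerBl ?sqrtr_ge0 //; lra.
(* [400 = 4 * 4 * 25], from [entropy_gap], [hell_singletons] and [hell_separated]. *)
exists 400^-1 => [|k d dT Omega P T r p Z D k0 herr mZ mD law ind].
  by rewrite invr_gt0.
apply: le_trans (cond_mutual_info_hell p k0 mZ mD law ind).
rewrite mulrC ler_wpM2l ?invr_ge0 ?ler0n // -mulr_sumr.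
have mX := finite_rv_pair mZ mD.
have sum1 := tlaw_sum1 p k0 mX ind.
have q0 := @message_prob_ge0 R k d dT Omega P T r p.
have := hell_singletons q0 sum1.
have and0 : AND ([ffun=> false] : {ffun 'I_k -> bool}) = false.
  by apply/negbTE/forallPn; exists (Ordinal k0); rewrite ffunE.
have and1 : AND ([ffun=> true] : {ffun 'I_k -> bool}) = true.
  by apply/forallP => i; rewrite ffunE.
have err0 := tlaw_error k0 mX ind [ffun=> false] herr.
have err1 := tlaw_error k0 mX ind [ffun=> true] herr.
have : 25^-1 <= hell (message_prob P r p) [ffun=> false] [ffun=> true].
  apply: (hell_separated q0 sum1 err0 _ eps_le).
  (* Errors on the all-zero input are the transcripts with output [true]; errors on the all-one
     input are their complement. *)
  apply: le_trans err1; apply: le_of_eq.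
  by apply: eq_bigl => m; rewrite and0 and1; case: (result p m).
by lra.
Qed.
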